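(* Let $\Omega\subset\mathbb{R}^n$ be a bounded Lipschitz domain, let $L$ be a Tonelli Lagrangian with associated Hamiltonian $H$, let $g:\partial\Omega\to\mathbb{R}$ satisfy $g(x)-g(y)\leq\Phi^{\Omega}_L(y,x)$ for all $x,y\in\partial\Omega$, and assume $c_{\Omega}(L)<0$. Then the function $u(x)=\inf_{y\in\partial\Omega}\{g(y)+\Phi^{\Omega}_L(y,x)\}$, $x\in\overline{\Omega}$, is a viscosity solution of the Dirichlet problem $$H(x,Du)=0\ \text{ in }\Omega,\qquad u|_{\partial\Omega}=g.$$
   Context: A Tonelli Lagrangian is a $C^2$ function $L:\mathbb{R}^n\times\mathbb{R}^n\to\mathbb{R}$ such that $\frac{\partial^2L}{\partial v^2}(x,v)$ is positive definite for all $(x,v)$, and there exist nondecreasing superlinear functions $\theta_1,\theta_2:[0,+\infty)\to[0,+\infty)$ (superlinear means $\theta(r)/r\to+\infty$ as $r\to+\infty$) and $c_0>0$ with $\theta_2(|v|)\geq L(x,v)\geq\theta_1(|v|)-c_0$ for all $(x,v)$. The associated Hamiltonian is $H(x,p)=\sup_{v}\{\langle p,v\rangle-L(x,v)\}$. A Lipschitz domain is a domain whose boundary is locally the graph of a Lipschitz function. For $x,y\in\overline{\Omega}$ and $s<t$, $\Gamma^{s,t}_{x,y}(\overline{\Omega})$ is the set of $\xi\in W^{1,1}([s,t];\mathbb{R}^n)$ with $\xi(\tau)\in\overline\Omega$ for all $\tau\in[s,t]$, $\xi(s)=x$, $\xi(t)=y$. For $t>0$, $$A^{\Omega}_t(x,y)=\inf_{\xi\in\Gamma^{0,t}_{x,y}(\overline{\Omega})}\int_0^tL(\xi,\dot\xi)\,ds,\quad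 \Phi^{\Omega}_L(x,y)=\inf_{t>0}A^{\Omega}_t(x,y),\quad c_{\Omega}(L)=-\inf_{t>0,\,x\in\overline{\Omega}}\tfrac1tA^{\Omega}_t(x,x).$$ *)

(* Defs.v *)
From HB Require Import structures.
From mathcomp Require Import all_boot all_order all_algebra.
From mathcomp Require Import all_classical all_reals all_analysis.

Set Implicit Arguments.
Unset Strict Implicit.
Unset Printing Implicit Defensive.

Import Order.TTheory GRing.Theory Num.Theory.
Import numFieldNormedType.Exports.

Local Open Scope classical_set_scope.
Local Open Scope ring_scope.

(** The norm that the library puts on ['rV[R]_n] is the sup norm. It is used
    only for topological notions (and Lipschitz continuity, with an unspecified
    constant), where it is interchangeable with [enorm]. *)

Definition dot (R : realType) (n : nat) (p v : 'rV[R]_n) : R :=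
  \sum_i p 0 i * v 0 i.

Definition enorm (R : realType) (n : nat) (v : 'rV[R]_n) : R :=
  Num.sqrt (dot v v).

Definition grad (R : realType) (n : nat) (f : 'rV[R]_n -> R) (x : 'rV[R]_n)
  : 'rV[R]_n := \row_i 'D_(delta_mx 0 i) f x.

Definition hessian (R : realType) (n : nat) (f : 'rV[R]_n -> R) (x : 'rV[R]_n)
  : 'M[R]_n := \matrix_(i, j) 'D_(delta_mx 0 i) ('D_(delta_mx 0 j) f) x.

Definition posdef (R : realType) (n : nat) (M : 'M[R]_n) : Prop :=
  forall w : 'rV[R]_n, w != 0 -> 0 < (w *m M *m w^T) 0 0.

(** Class [C^k] on the open set [D] of a finite-dimensional space [V]. *)
Fixpoint Ck_on (R : realType) (V : normedModType R) (D : set V) (k : nat)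
    (f : V -> R) : Prop :=
  if k is k'.+1 then
    (forall z, D z -> differentiable f z) /\
    (forall h : V, Ck_on D k' ('D_h f))
  else forall z, D z -> {for z, continuous f}.

(** Functions [[0, +oo) -> [0, +oo)] are represented by functions on [R], whose
    values on negative reals are irrelevant. *)
Definition nondecr_superlinear (R : realType) (theta : R -> R) : Prop :=
  [/\ forall r : R, 0 <= r -> 0 <= theta r,
      forall r s : R, 0 <= r -> r <= s -> theta r <= theta s
    & theta r / r @[r --> +oo] --> +oo].

Definition tonelli (R : realType) (n : nat) (L : 'rV[R]_n -> 'rV[R]_n -> R)
  : Prop :=
  [/\ Ck_on setT 2 (fun z : 'rV[R]_n * 'rV[R]_n => L z.1 z.2),
      forall x v, posdef (hessian (L x) v)
    & exists theta1 theta2 : R -> R, exists c0 : R,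
      [/\ nondecr_superlinear theta1, nondecr_superlinear theta2, 0 < c0
        & forall x v, theta1 (enorm v) - c0 <= L x v /\
                      L x v <= theta2 (enorm v)]].

Definition hamiltonian (R : realType) (n : nat) (L : 'rV[R]_n -> 'rV[R]_n -> R)
    (x p : 'rV[R]_n) : \bar R :=
  ereal_sup [set (dot p v - L x v)%:E | v in [set: 'rV[R]_n]].

Definition boundary (T : topologicalType) (A : set T) : set T :=
  closure A `\` interior A.

Definition domain (R : realType) (n : nat) (Omega : set 'rV[R]_n) : Prop :=
  [/\ Omega !=set0, open Omega & connected Omega].

(** The Cartesian coordinates of the local graph are given by its vertical unit
    vector [e]: a point [z] has height [dot z e] above its orthogonal projection
    [z - dot z e *: e] to the hyperplane [e^perp], where [f] is Lipschitz. *)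
Definition lipschitz_domain (R : realType) (n : nat) (Omega : set 'rV[R]_n)
  : Prop :=
  domain Omega /\
  forall x : 'rV[R]_n, boundary Omega x ->
    exists (U : set 'rV[R]_n) (e : 'rV[R]_n) (f : 'rV[R]_n -> R),
      [/\ nbhs x U, enorm e = 1, [lipschitz f p | p in [set p | dot p e = 0]]
        & boundary Omega `&` U =
          [set z | dot z e = f (z - dot z e *: e)] `&` U].

(** [xi], as a continuous curve defined at every point of [[s, t]], is in
    [W^{1,1}([s, t]; R^n)] with weak derivative [v] (determined almost
    everywhere): [v] is in [L^1] and [xi] is a primitive of [v]. *)
Definition W11_deriv (R : realType) (n : nat) (s t : R) (xi v : R -> 'rV[R]_n)
  : Prop :=
  (forall i, (@lebesgue_measure R).-integrable `[s, t]
               (fun r => (v r 0 i)%:E)) /\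
  (forall r i, s <= r <= t ->
    xi r 0 i = xi s 0 i + \int[@lebesgue_measure R]_(q in `[s, r]) v q 0 i).

Definition Gamma (R : realType) (n : nat) (Omega : set 'rV[R]_n) (s t : R)
    (x y : 'rV[R]_n) : set (R -> 'rV[R]_n) :=
  [set xi | [/\ exists v, W11_deriv s t xi v,
                forall r, s <= r <= t -> closure Omega (xi r),
                xi s = x & xi t = y]].

(** When [L] is Tonelli the negative part of the integrand is bounded, so the
    integral below is well defined in [(-oo, +oo]]. *)
Definition action (R : realType) (n : nat) (L : 'rV[R]_n -> 'rV[R]_n -> R)
    (t : R) (xi v : R -> 'rV[R]_n) : \bar R :=
  (\int[@lebesgue_measure R]_(r in `[0%R, t]) (L (xi r) (v r))%:E)%E.

Definition min_action (R : realType) (n : nat) (Omega : set 'rV[R]_n)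
    (L : 'rV[R]_n -> 'rV[R]_n -> R) (t : R) (x y : 'rV[R]_n) : \bar R :=
  ereal_inf [set a | exists xi v, [/\ Gamma Omega 0 t x y xi,
                       W11_deriv 0 t xi v & a = action L t xi v]].

Definition mane_potential (R : realType) (n : nat) (Omega : set 'rV[R]_n)
    (L : 'rV[R]_n -> 'rV[R]_n -> R) (x y : 'rV[R]_n) : \bar R :=
  ereal_inf [set min_action Omega L t x y | t in [set t : R | 0 < t]].

Definition critical_value (R : realType) (n : nat) (Omega : set 'rV[R]_n)
    (L : 'rV[R]_n -> 'rV[R]_n -> R) : \bar R :=
  (- ereal_inf [set a | exists (t : R) (x : 'rV[R]_n),
       [/\ (0 < t)%R, closure Omega x
         & a = t^-1%:E * min_action Omega L t x x]])%E.

Definition viscosity_subsolution (R : realType) (n : nat)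
    (H : 'rV[R]_n -> 'rV[R]_n -> \bar R) (Omega : set 'rV[R]_n)
    (u : 'rV[R]_n -> R) : Prop :=
  forall (phi : 'rV[R]_n -> R) (x : 'rV[R]_n), Ck_on Omega 1 phi -> Omega x ->
    (\forall y \near x, u y - phi y <= u x - phi x) ->
    (H x (grad phi x) <= 0)%E.

Definition viscosity_supersolution (R : realType) (n : nat)
    (H : 'rV[R]_n -> 'rV[R]_n -> \bar R) (Omega : set 'rV[R]_n)
    (u : 'rV[R]_n -> R) : Prop :=
  forall (phi : 'rV[R]_n -> R) (x : 'rV[R]_n), Ck_on Omega 1 phi -> Omega x ->
    (\forall y \near x, u x - phi x <= u y - phi y) ->
    (0 <= H x (grad phi x))%E.

Definition dirichlet_viscosity_solution (R : realType) (n : nat)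
    (H : 'rV[R]_n -> 'rV[R]_n -> \bar R) (Omega : set 'rV[R]_n)
    (g u : 'rV[R]_n -> R) : Prop :=
  [/\ {within closure Omega, continuous u},
      viscosity_subsolution H Omega u,
      viscosity_supersolution H Omega u
    & forall x, boundary Omega x -> u x = g x].

Definition value_function (R : realType) (n : nat) (Omega : set 'rV[R]_n)
    (L : 'rV[R]_n -> 'rV[R]_n -> R) (g : 'rV[R]_n -> R) (x : 'rV[R]_n)
  : \bar R :=
  ereal_inf [set ((g y)%:E + mane_potential Omega L y x)%E
            | y in boundary Omega].

(* Main.v *)
Require Import Defs.
From HB Require Import structures.
From mathcomp Require Import all_boot all_order all_algebra.
From mathcomp Require Import all_classical all_reals all_analysis.
From mathcomp Require Import ring lra measurable_realfun.

(** The value function [u] is dominated by [L]: along a straight segment in the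
    closure of [Omega] it grows by at most the action of the segment. Since the
    closure of a Lipschitz domain is locally connected by two-segment paths of
    length comparable to the distance, [u] is locally Lipschitz and finite, and
    small segments inside [Omega] give the subsolution property.

    For the supersolution property, suppose that [phi] touches [u] from below at
    [x] with [H x p < 0], where [p = grad phi x]. By superlinearity of [L] there
    is [k > 0] with [dot q v <= L y v] for all [v], all [y] near [x] and all [q]
    within [k] of [p]. Follow a nearly optimal curve for [u x] after its last
    exit [z] from the [l^1]-ball of radius [r] around [x], and take
    [q = p + k * sign (x - z)]: the action spent is at least
    [dot q (x - z) = dot p (x - z) + k * r], whereas touching only allows
    [dot p (x - z) + o(r)]. Linear functionals of the velocity integrate
    exactly, so no chain rule along Sobolev curves is needed. *)

Import Order.TTheory GRing.Theory Num.Theory.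
Import numFieldNormedType.Exports.
Local Open Scope classical_set_scope.
Local Open Scope ring_scope.

Set Implicit Arguments.
Unset Strict Implicit.
Unset Printing Implicit Defensive.

(** * Measurability and concatenation of curves *)

Lemma mx_coord_le (R : realType) (n : nat) (v : 'rV[R]_n) (i : 'I_n) :
  `|v 0 i| <= `|v|.
Proof.
rewrite [leRHS]/Num.norm /= mx_normrE.
exact: (le_bigmax _ (fun ij : 'I_1 * 'I_n => `|v ij.1 ij.2|) (0, i)).
Qed.

Lemma mx_norm_le_sum (R : realType) (n : nat) (v : 'rV[R]_n) :
  `|v| <= \sum_i `|v 0 i|.
Proof.
rewrite [leLHS]/Num.norm /= mx_normrE; apply/bigmax_leP; split=> [|[i j] _] /=.
  by apply: sumr_ge0 => i _.
by rewrite ord1 (bigD1 j) //= lerDl sumr_ge0.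
Qed.

(* An open set is a countable union of boxes with rational vertices. *)
Lemma measurable_fun_continuous_pair (d : measure_display)
    (T : measurableType d) (R : realType) (n m : nat) (D : set T)
    (F : 'rV[R]_n * 'rV[R]_m -> R) (f : T -> 'rV[R]_n) (g : T -> 'rV[R]_m) :
  measurable D -> continuous F ->
  (forall i, measurable_fun D (fun s => f s 0 i)) ->
  (forall i, measurable_fun D (fun s => g s 0 i)) ->
  measurable_fun D (fun s => F (f s, g s)).
Proof.
move=> mD cF mf mg.
suff mU : forall U : set ('rV[R]_n * 'rV[R]_m), open U ->
    measurable (D `&` [set s | U (f s, g s)]).
  apply: (measurability _ (RGenOpens.measurableE R)).
  move=> _ [_ [a [b ->] <-]]; apply: (mU (F @^-1` `]a, b[%classic)).
  by move/continuousP : cF; apply; exact: interval_open.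
move=> U oU.
pose box (z : 'rV[rat]_n * 'rV[rat]_m * rat) : set ('rV[R]_n * 'rV[R]_m) :=
  [set w : 'rV[R]_n * 'rV[R]_m | (forall i, `|w.1 0 i - ratr (z.1.1 0 i)| < ratr z.2) /\
           (forall i, `|w.2 0 i - ratr (z.1.2 0 i)| < ratr z.2)].
have -> : D `&` [set s | U (f s, g s)] =
    \bigcup_z (if `[< box z `<=` U >]
               then D `&` [set s | box z (f s, g s)] else set0).
  apply/seteqP; split => [s [Ds Us]|s [z _]]; last first.
    by case: ifPn => // /asboolP zU [Ds /zU].
  have /nbhs_ballP[e /= e0 eU] : nbhs (f s, g s) U by exact: open_nbhs_nbhs.
  (* Half of [e], so that two points of one box, each within [q] of its center, are within [e] of
     each other. *)
  have [q qe] : exists q : rat, 0 < (ratr q : R) < e / 2.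
    have /rat_in_itvoo[q] : 0 < e / 2 by rewrite divr_gt0.
    by rewrite in_itv /=; exists q.
  have approx k (w : 'rV[R]_k) : exists c : 'rV[rat]_k,
      forall i, `|w 0 i - ratr (c 0 i)| < ratr q.
    have H i : exists c : rat, `|w 0 i - ratr c| < ratr q.
      have /rat_in_itvoo[c] : w 0 i - ratr q < w 0 i + ratr q by lra.
      by rewrite in_itv /= => ?; exists c; rewrite ltr_norml; lra.
    have [c Hc] := choice H; exists (\row_i c i) => i; by rewrite mxE.
  have [c1 Hc1] := approx _ (f s); have [c2 Hc2] := approx _ (g s).
  have boxs : box (c1, c2, q) (f s, g s) by [].
  exists (c1, c2, q) => //; rewrite ifT //; apply/asboolP => -[w1 w2] [/= H1 H2].
  have close (a b c : R) : `|a - c| < ratr q -> `|b - c| < ratr q -> `|a - b| < e.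
    rewrite !ltr_norml; lra.
  apply: eU; split; split => //= i j; rewrite ord1;
    by rewrite /ball_ /=; apply: close.
apply: countable_bigcupT_measurable => [|z]; first exact: countableP.
case: ifPn => // _.
have mbox k (h : T -> 'rV[R]_k) (c : 'rV[rat]_k) (q : rat) :
    (forall i, measurable_fun D (fun s => h s 0 i)) ->
    measurable (D `&` [set s | forall i, `|h s 0 i - ratr (c 0 i)| < ratr q]).
  move=> mh.
  have -> : D `&` [set s | forall i, `|h s 0 i - ratr (c 0 i)| < ratr q] =
      D `&` \bigcap_(i in [set: 'I_k]) (D `&` (fun s => h s 0 i) @^-1`
        `]ratr (c 0 i) - ratr q, ratr (c 0 i) + ratr q[%classic).
    apply/seteqP; split => s [Ds H]; split => // i.
      by move=> _; split => //=; have := H i; rewrite in_itv /= ltr_norml; lra.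
    by have [_] := H i Logic.I; rewrite /= in_itv /= ltr_norml; lra.
  apply: measurableI => //; apply: fin_bigcap_measurable => // i _.
  exact: mh.
rewrite [X in measurable X](_ : _ =
    (D `&` [set s | forall i, `|f s 0 i - ratr (z.1.1 0 i)| < ratr z.2]) `&`
    (D `&` [set s | forall i, `|g s 0 i - ratr (z.1.2 0 i)| < ratr z.2])).
  by apply: measurableI; exact: mbox.
by apply/seteqP; split => s /=; rewrite /box /=; tauto.
Qed.

Section curves.
Context (R : realType) (n : nat).
Notation mu := (@lebesgue_measure R).
Implicit Types (xi v : R -> 'rV[R]_n) (L : 'rV[R]_n -> 'rV[R]_n -> R).

Lemma W11_continuous (s t : R) xi v (i : 'I_n) : s <= t -> W11_deriv s t xi v ->
  {within `[s, t], continuous (fun r => xi r 0 i)}.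
Proof.
move=> st [vint xiE].
have /= c1 := parameterized_integral_continuous st (vint i).
apply: (@subspace_eq_continuous _ _ _
  (fun r => xi s 0 i + parameterized_integral mu s r (fun q => v q 0 i))).
  move=> r; rewrite inE /= in_itv /= => rst. by rewrite [RHS](xiE r i rst).
move=> r; apply: (@continuousD R R (subspace `[s, t]) (cst (xi s 0 i))
  (fun x => parameterized_integral mu s x (fun q => v q 0 i))); last exact: c1.
exact: cvg_cst.
Qed.

Lemma action_measurable (s t : R) xi v L : s <= t -> W11_deriv s t xi v ->
  continuous (fun z : 'rV[R]_n * 'rV[R]_n => L z.1 z.2) ->
  measurable_fun `[s, t] (fun r => L (xi r) (v r)).
Proof.
move=> st Hxi cL; apply: (measurable_fun_continuous_pair _ cL) => // i.
  by apply: subspace_continuous_measurable_fun => //; exact: W11_continuous Hxi.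
by have [/(_ i)/integrableP[/measurable_EFinP]] := Hxi.
Qed.

(** The negative part is bounded by [c] on an interval of finite length, so its integral is finite;
    an infinite integral of the positive part would then make the action infinite. *)
Lemma action_integrable (t : R) xi v L (c : R) : 0 <= t ->
  W11_deriv 0 t xi v ->
  continuous (fun z : 'rV[R]_n * 'rV[R]_n => L z.1 z.2) ->
  (forall x w, - c <= L x w) -> 0 <= c ->
  (action L t xi v < +oo)%E ->
  mu.-integrable `[0, t] (fun r => (L (xi r) (v r))%:E).
Proof.
move=> t0 Hxi cL Lc c0 Afin.
have mL := action_measurable t0 Hxi cL.
have mLE : measurable_fun `[0, t] (fun r => (L (xi r) (v r))%:E).
  exact/measurable_EFinP.
apply/integrableP; split=> //.
have negfin : (\int[mu]_(r in `[0%R, t]) ((fun r => (L (xi r) (v r))%:E)^\- r) < +oo)%E.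
  apply: (@le_lt_trans _ _ (\int[mu]_(r in `[0%R, t]) (cst c%:E r))%E).
    apply: ge0_le_integral => //.
    - exact: measurable_funeneg.
    - by move=> r _; rewrite funenegE ge_max !lee_fin c0 andbT lerNl Lc.
  by rewrite integral_cst //= lebesgue_measure_itv /= lte_fin; case: ifP => _;
    rewrite ?mule0 // sube0 -EFinM ltry.
move: Afin; rewrite /action integralE => Afin.
rewrite (_ : (fun r => _) = (fun r => (L (xi r) (v r))%:E)^\+ \+
    (fun r => (L (xi r) (v r))%:E)^\-)%E; last first.
  exact: (fune_abse (fun r => (L (xi r) (v r))%:E)).
rewrite ge0_integralD //; [|exact: measurable_funepos|exact: measurable_funeneg].
rewrite lte_add_pinfty // ltey; apply/eqP => posoo.
move: Afin; rewrite posoo addye ?ltxx // eqe_oppLR /=.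
by apply: contraTneq negfin => ->; rewrite ltxx.
Qed.

Lemma itvcc_setU (a b c : R) : a <= b -> b <= c ->
  `[a, c]%classic = `[a, b]%classic `|` `]b, c]%classic.
Proof. by move=> ab bc; apply: itv_bndbnd_setU; rewrite bnd_simp. Qed.

Lemma itvcc_disj (a b c : R) : [disjoint `[a, b]%classic & `]b, c]%classic].
Proof.
apply/disj_setPS => r [/=]; rewrite !in_itv /= => /andP[_ rb] /andP[br _].
by move: (lt_le_trans br rb); rewrite ltxx.
Qed.

Lemma integrable_itvcc (a b c : R) (f : R -> R) : a <= b -> b <= c ->
  mu.-integrable `[a, b] (EFin \o f) -> mu.-integrable `]b, c] (EFin \o f) ->
  mu.-integrable `[a, c] (EFin \o f).
Proof.
move=> ab bc /integrableP[mf1 f1] /integrableP[mf2 f2].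
have mf : measurable_fun `[a, c] (EFin \o f).
  by rewrite (itvcc_setU ab bc) measurable_funU.
apply/integrableP; split=> //; move: mf; rewrite (itvcc_setU ab bc) => mf.
rewrite ge0_integral_setU //; [exact: lte_add_pinfty| |exact: itvcc_disj].
exact: measurableT_comp.
Qed.

Lemma integrable_itv_cst (a b k : R) :
  mu.-integrable `]a, b] (EFin \o cst k).
Proof.
apply: measurable_bounded_integrable => //.
  by rewrite /= lebesgue_measure_itv /=; case: ifP; rewrite // -EFinB ltry.
exists `|k|; split; first exact: num_real.
by move=> M kM r _ /=; exact: ltW.
Qed.

(** The value at [t] comes from [f], which matches the splitting of intervals into [[a, t]] and []t,
    b]]. *)
Definition glue (t : R) (f g : R -> 'rV[R]_n) : R -> 'rV[R]_n :=
  fun r => if r <= t then f r else g r.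

Lemma glue_le (t r : R) f g : r <= t -> glue t f g r = f r.
Proof. by rewrite /glue => ->. Qed.

Lemma glue_gt (t r : R) f g : t < r -> glue t f g r = g r.
Proof. by rewrite /glue ltNge => /negPf ->. Qed.

Lemma W11_glue (t h : R) xi v (w : 'rV[R]_n) : 0 <= t -> 0 <= h ->
  W11_deriv 0 t xi v ->
  W11_deriv 0 (t + h) (glue t xi (fun r => xi t + (r - t) *: w))
    (glue t v (cst w)).
Proof.
move=> t0 h0 [vint xiE].
have tth : t <= t + h by rewrite lerDl.
have wint i r : mu.-integrable `]t, r] (EFin \o (fun r => glue t v (cst w) r 0 i)).
  apply: (@eq_integrable _ _ _ _ _ _ (cst (w 0 i)%:E)) => //.
    by move=> q; rewrite inE /= in_itv /= => /andP[tq _]; rewrite glue_gt.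
  exact: (integrable_itv_cst _ _ (w 0 i)).
have vint' i r : r <= t ->
    mu.-integrable `[0, r] (EFin \o (fun r => glue t v (cst w) r 0 i)).
  move=> rt; apply: (@eq_integrable _ _ _ mu `[0, r]%classic (measurable_itv _)
    (EFin \o (fun r => v r 0 i))).
    move=> q; rewrite inE /= in_itv /= => /andP[_ qr].
    by rewrite glue_le // (le_trans qr).
  apply: integrableS (vint i) => //; apply: subset_itvl; by rewrite bnd_simp.
have intE i r : r <= t -> \int[mu]_(q in `[0, r]) glue t v (cst w) q 0 i =
    \int[mu]_(q in `[0, r]) v q 0 i.
  move=> rt; apply: eq_Rintegral => q; rewrite inE /= in_itv /= => /andP[_ qr].
  by rewrite glue_le // (le_trans qr).
split=> [i|r i /andP[r0 rth]].
  exact: (integrable_itvcc t0 tth (vint' i t (lexx t)) (wint i _)).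
rewrite (glue_le _ _ t0); have [rt|tr] := leP r t.
  by rewrite glue_le // intE // xiE // r0.
rewrite glue_gt // (itvcc_setU t0 (ltW tr)) Rintegral_setU //; last 2 first.
- rewrite -(itvcc_setU t0 (ltW tr)).
  exact: (integrable_itvcc t0 (ltW tr) (vint' i t (lexx t)) (wint i _)).
- exact: itvcc_disj.
rewrite intE // addrA -xiE ?t0 //= !mxE; congr (_ + _).
rewrite (@eq_Rintegral _ _ _ _ _ (cst (w 0 i))); last first.
  by move=> q; rewrite inE /= in_itv /= => /andP[tq _]; rewrite glue_gt.
by rewrite Rintegral_cst //= lebesgue_measure_itv /= lte_fin tr -EFinD /= mulrC.
Qed.

Lemma W11_restrict (s t : R) xi v : s <= t -> W11_deriv 0 t xi v ->
  W11_deriv 0 s xi v.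
Proof.
move=> st [vint xiE]; split=> [i|r i /andP[r0 rs]].
  apply: integrableS (vint i) => //; apply: subset_itvl; by rewrite bnd_simp.
by apply: xiE; rewrite r0 (le_trans rs).
Qed.

Lemma Gamma_restrict (Omega : set 'rV[R]_n) (s t : R) (x y : 'rV[R]_n) xi :
  s <= t -> Gamma Omega 0 t x y xi -> Gamma Omega 0 s x (xi s) xi.
Proof.
move=> st [[v Hv] cl x0 _]; split=> //.
  by exists v; exact: W11_restrict Hv.
by move=> r /andP[r0 rs]; apply: cl; rewrite r0 (le_trans rs).
Qed.

(** * Action of a curve extended by a segment *)

Section action.
Context (L : 'rV[R]_n -> 'rV[R]_n -> R) (c : R).
Hypothesis cL : continuous (fun z : 'rV[R]_n * 'rV[R]_n => L z.1 z.2).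
Hypothesis Lc : forall x w, - c <= L x w.
Hypothesis c0 : 0 <= c.

Lemma action_split (s t : R) xi v : 0 <= s -> s <= t -> W11_deriv 0 t xi v ->
  action L t xi v =
  (action L s xi v + \int[mu]_(r in `]s, t]) (L (xi r) (v r))%:E)%E.
Proof.
move=> s0 st Hxi; rewrite /action (itvcc_setU s0 st) integral_setU //.
  rewrite -(itvcc_setU s0 st); apply/measurable_EFinP.
  exact: (action_measurable (le_trans s0 st) Hxi cL).
exact: itvcc_disj.
Qed.

(** Prolonging [xi] from [y] at constant velocity [w] during time [h] gives an admissible curve, and
    the added piece costs at most [B * h]. *)
Lemma min_action_segment (Omega : set 'rV[R]_n) (t h B : R) (z y w : 'rV[R]_n)
    xi v : 0 <= t -> 0 <= h -> Gamma Omega 0 t z y xi -> W11_deriv 0 t xi v ->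
  (forall s, 0 <= s <= h -> closure Omega (y + s *: w)) ->
  (forall s, 0 <= s <= h -> L (y + s *: w) w <= B) ->
  (min_action Omega L (t + h) z (y + h *: w) <= action L t xi v + (B * h)%:E)%E.
Proof.
move=> t0 h0 [_ cl xi0 xit] Hv clw LB.
have tth : t <= t + h by rewrite lerDl.
have Hv' := W11_glue w t0 h0 Hv.
set xi' := glue _ _ _ in Hv'; set v' := glue _ _ _ in Hv'.
have xi'E r : t <= r -> xi' r = y + (r - t) *: w.
  rewrite /xi' le_eqVlt => /predU1P[<-|tr]; last by rewrite glue_gt ?xit.
  by rewrite glue_le // subrr scale0r addr0.
apply: (@le_trans _ _ (action L (t + h) xi' v')).
  apply: ereal_inf_lbound; exists xi', v'; split=> //; split.
  - by exists v'.
  - move=> r /andP[r0 rth]; have [rt|tr] := leP r t.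
      by rewrite /xi' glue_le //; apply: cl; rewrite r0.
    by rewrite xi'E ?(ltW tr) //; apply: clw; lra.
  - by rewrite /xi' glue_le.
  - by rewrite xi'E // [t + h]addrC addrK.
rewrite (action_split t0 tth Hv'); apply: leeD.
  rewrite /action le_eqVlt; apply/predU1P; left; apply: eq_integral => r.
  by rewrite inE /= in_itv /= => /andP[_ rt]; rewrite /xi' /v' !glue_le.
have -> : ((B * h)%:E = \int[mu]_(r in `]t, (t + h)%R]) B%:E)%E.
  rewrite integral_cst //= lebesgue_measure_itv /= lte_fin ltrDl.
  case: ltP => h0'; first by rewrite -EFinB -EFinM [t + h]addrC addrK.
  by have -> : h = 0 by [apply/le_anti; rewrite h0 h0']; rewrite mulr0 mule0.
have mth : (mu `]t, (t + h)%R]%classic < +oo)%E.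
  by rewrite /= lebesgue_measure_itv /=; case: ifP; rewrite // -EFinB ltry.
have LB' r : r \in `]t, t + h]%classic -> L (xi' r) (v' r) <= B.
  rewrite inE /= in_itv /= => /andP[tr rth]; rewrite xi'E ?(ltW tr) //.
  by rewrite /v' glue_gt //; apply: LB; lra.
apply: le_integral => //.
(* On the added piece [L] lies between [- c] and [B], hence is integrable. *)
- apply: (@measurable_bounded_integrable _ _ _ mu
    (fun r => L (xi' r) (v' r))) => //.
    apply: measurable_funS (action_measurable (addr_ge0 t0 h0) Hv' cL) => //.
    by apply: subset_itvr; rewrite bnd_simp.
  exists (`|B| + c); split; first exact: num_real.
  move=> M BM r /= tr; have := Lc (xi' r) (v' r).
  have := LB' r; rewrite inE => /(_ tr); rewrite ler_norml => H1 H2.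
  have := ler_norm B; have := normr_ge0 B; have := c0 => ? ? ?.
  by apply/andP; split; lra.
- exact: (integrable_itv_cst _ _ B).
Qed.

(** Infimum of the previous bound over all curves and all times [t]; [t + h] is again a positive
    time. *)
Lemma mane_segment (Omega : set 'rV[R]_n) (h B : R) (z y w : 'rV[R]_n) :
  0 <= h ->
  (forall s, 0 <= s <= h -> closure Omega (y + s *: w)) ->
  (forall s, 0 <= s <= h -> L (y + s *: w) w <= B) ->
  (mane_potential Omega L z (y + h *: w) <=
   mane_potential Omega L z y + (B * h)%:E)%E.
Proof.
move=> h0 clw LB; rewrite -leeBlDr //; apply: le_ereal_inf_tmp.
move=> _ [t /= t0 <-]; apply: le_ereal_inf_tmp => _ [xi [v [Gxi Hv ->]]].
rewrite EFinN leeBlDr //.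
apply: le_trans (min_action_segment (ltW t0) h0 Gxi Hv clw LB).
by apply: ereal_inf_lbound; exists (t + h) => //=; rewrite ltr_pwDl.
Qed.

End action.
End curves.

(** * Paths in the closure of a Lipschitz domain *)

Definition seg_in (R : realType) (n : nat) (S : set 'rV[R]_n)
    (a b : 'rV[R]_n) : Prop :=
  forall s : R, 0 <= s <= 1 -> S (a + s *: (b - a)).

Section segments.
Context (R : realType) (n : nat).
Implicit Types (S Omega : set 'rV[R]_n) (a b x y : 'rV[R]_n).

Lemma seg_in_sym S a b : seg_in S a b -> seg_in S b a.
Proof.
move=> ab s s01; have -> : b + s *: (a - b) = a + (1 - s) *: (b - a).
  apply/rowP => i; rewrite !mxE; ring.
by apply: ab; lra.
Qed.

Lemma seg_in_start S a b : seg_in S a b -> S a.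
Proof. by move/(_ 0); rewrite scale0r addr0 lexx ler01; exact. Qed.

Lemma seg_in_end S a b : seg_in S a b -> S b.
Proof. by move/seg_in_sym/seg_in_start. Qed.

Lemma seg_in_sub S S' a b : S `<=` S' -> seg_in S a b -> seg_in S' a b.
Proof. by move=> SS' ab s /ab/SS'. Qed.

Lemma seg_in_ball (x0 a b : 'rV[R]_n) (r : R) :
  `|a - x0| < r -> `|b - x0| < r -> seg_in [set z | `|z - x0| < r] a b.
Proof.
move=> ar br s /andP[s0 s1] /=.
have -> : a + s *: (b - a) - x0 = (1 - s) *: (a - x0) + s *: (b - x0).
  apply/rowP => i; rewrite !mxE; ring.
apply: le_lt_trans (ler_normD _ _) _; rewrite !normrZ.
rewrite (ger0_norm s0) ger0_norm ?subr_ge0 //.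
have [->|s0'] := eqVneq s 0; first by rewrite subr0 mul1r mul0r addr0.
have {}s0 : 0 < s by rewrite lt_def s0'.
have : (1 - s) * `|a - x0| <= (1 - s) * r.
  by rewrite ler_wpM2l ?subr_ge0 // ltW.
have : s * `|b - x0| < s * r by rewrite ltr_pM2l.
lra.
Qed.

Lemma boundary_open Omega x : open Omega ->
  boundary Omega x <-> closure Omega x /\ ~ Omega x.
Proof.
by move=> /interior_id oO; rewrite /boundary oO.
Qed.

Lemma closure_not_boundary Omega x : open Omega -> closure Omega x ->
  ~ boundary Omega x -> Omega x.
Proof.
move=> oO clx nb; apply: contrapT => nx; apply: nb.
by apply/boundary_open.
Qed.

(** Off the boundary, belonging to [Omega] and to its closure are the same, so the trace of [Omega]
    on the segment is open and closed in it; the segment is connected. *)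
Lemma seg_in_open Omega a b : open Omega ->
  seg_in [set z | ~ boundary Omega z] a b -> Omega a -> seg_in Omega a b.
Proof.
move=> oO nb Oa.
pose T := (fun s : R => a + s *: (b - a)) @` `[0, 1]%classic.
have cT : connected T.
  apply: connected_continuous_connected; first exact: segment_connected.
  apply: continuous_subspaceT => s; apply: cvgD; first exact: cvg_cst.
  by apply: cvgZr_tmp.
have TO : T `&` Omega = T.
  apply: cT.
  - by exists a; split=> //; exists 0; rewrite ?scale0r ?addr0 //= in_itv /= lexx ler01.
  - by exists Omega.
  - exists (closure Omega); first exact: closed_closure.
    apply/seteqP; split => z [Tz Oz]; split => //; first exact: subset_closure.
    apply: closure_not_boundary => //.
    by case: Tz => s /=; rewrite in_itv /= => /nb + <-.
move=> s s01; have : T (a + s *: (b - a)) by exists s => //=; rewrite in_itv.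
by rewrite -TO => -[].
Qed.

End segments.

(* [F] is the height above a Lipschitz graph in the vertical direction [e]. The
   graph admits interior cones, so two points on or above it are joined by a
   two-segment path through a point lifted proportionally to their distance. *)
Section graph.
Context (R : realType) (n : nat) (Omega : set 'rV[R]_n) (x0 e : 'rV[R]_n).
Context (F : 'rV[R]_n -> R) (Lam rho : R).
Hypothesis oO : open Omega.
Hypothesis e1 : `|e| <= 1.
Hypothesis Lam0 : 0 <= Lam.
Hypothesis Fe : forall z s, F (z + s *: e) = F z + s.
Hypothesis FLam : forall z z', `|F z - F z'| <= Lam * `|z - z'|.
Hypothesis FO : forall z, `|z - x0| < rho -> (boundary Omega z <-> F z = 0).

Let apex (x y : 'rV[R]_n) := 2^-1 *: (x + y) + (Lam * `|x - y|) *: e.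

Let apexC x y : apex x y = apex y x.
Proof. by rewrite /apex distrC [x + y]addrC. Qed.

Let apex_path x y s :
  x + s *: (apex x y - x) = (x + (s / 2) *: (y - x)) + (s * (Lam * `|x - y|)) *: e.
Proof. by apply/rowP => i; rewrite !mxE; field. Qed.

Let apex_dist x y : `|apex x y - x| <= (2^-1 + Lam) * `|x - y|.
Proof.
have := apex_path x y 1; rewrite scale1r !mul1r.
rewrite [x + (apex x y - x)]addrC subrK => ->.
rewrite addrAC [x + _ *: _]addrC addrK; apply: le_trans (ler_normD _ _) _.
have Ld : 0 <= Lam * `|x - y| by rewrite mulr_ge0.
rewrite normrZ [X in _ + X]normrZ [`|y - x|]distrC (ger0_norm Ld) ger0_norm // mulrDl lerD2l.
by rewrite ler_piMr.
Qed.

(** The move by [s / 2] towards [y] lowers [F] by at most half of [s * (Lam * |x - y|)], which is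
    the amount gained by the lift along [e]. *)
Let apex_above x y s : 0 <= s -> F x <= F (x + s *: (apex x y - x)).
Proof.
move=> s0; rewrite apex_path Fe.
have := FLam (x + (s / 2) *: (y - x)) x.
rewrite [x + _]addrC addrK normrZ [`|y - x|]distrC ger0_norm ?divr_ge0 //.
rewrite ler_norml => /andP[+ _].
have : 0 <= s * (Lam * `|x - y|) by rewrite !mulr_ge0.
by set t := s * _; rewrite (_ : Lam * _ = t / 2); [lra|rewrite /t; field].
Qed.

(** The factor comes from [(2^-1 + Lam) * (2 * d) + d]: the distance from [x] to the apex, then from
    [x] to [x0]. *)
Let apex_near x y d : `|x - x0| < d -> `|y - x0| < d ->
  seg_in [set z | `|z - x0| < (2 + 2 * Lam) * d] x (apex x y).
Proof.
move=> xd yd; apply: seg_in_ball.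
  have : 0 <= Lam * d by rewrite mulr_ge0 // ltW // (le_lt_trans _ xd).
  by have := normr_ge0 (x - x0); lra.
have := ler_normD (apex x y - x) (x - x0); rewrite addrA subrK.
have xy : `|x - y| < 2 * d.
  have := ler_normB (x - x0) (y - x0); rewrite opprB addrA subrK; lra.
have := apex_dist x y.
have : (2^-1 + Lam) * `|x - y| <= (2^-1 + Lam) * (2 * d).
  by apply: ler_wpM2l (ltW xy); rewrite addr_ge0 ?invr_ge0.
lra.
Qed.

Let above_notin x y d : (2 + 2 * Lam) * d <= rho ->
  `|x - x0| < d -> `|y - x0| < d -> 0 < F x ->
  seg_in [set z | ~ boundary Omega z] x (apex x y).
Proof.
move=> drho xd yd Fx s s01 /=.
have sd := lt_le_trans (apex_near xd yd s01) drho.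
move/(FO sd) => F0; have := @apex_above x y s; rewrite F0.
by case/andP: s01 => s0 _ /(_ s0); lra.
Qed.

(** Both legs of the path from [x] to [y] through the apex keep [F] positive, so they avoid the
    boundary and membership in [Omega] propagates along them. *)
Let above_in x y d : (2 + 2 * Lam) * d <= rho ->
  `|x - x0| < d -> `|y - x0| < d -> 0 < F x -> 0 < F y -> Omega x -> Omega y.
Proof.
move=> drho xd yd Fx Fy Ox.
have /seg_in_end Om := seg_in_open oO (above_notin drho xd yd Fx) Ox.
have := above_notin drho yd xd Fy; rewrite apexC => /seg_in_sym nb.
exact: seg_in_end (seg_in_open oO nb Om).
Qed.

Lemma above_closure x y d : (2 + 2 * Lam) * d <= rho ->
  `|x - x0| < d -> `|y - x0| < d -> 0 < F x -> Omega x -> 0 <= F y ->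
  closure Omega y.
Proof.
move=> drho xd yd Fx Ox; rewrite le_eqVlt => /predU1P[Fy|Fy].
  have yrho : `|y - x0| < rho.
    have d0 : 0 <= d by rewrite ltW // (le_lt_trans _ yd).
    have : 0 <= Lam * d by rewrite mulr_ge0.
    lra.
  by case: ((boundary_open y oO).1 ((FO yrho).2 (esym Fy))).
by apply: subset_closure; exact: (above_in drho xd yd Fx Fy Ox).
Qed.

(** Two radii are used: the endpoints lie in the ball of radius [d'], so that the path through the
    apex stays in the ball of radius [d], where nonnegative height implies membership in the
    closure. *)
Lemma above_chain x y z d d' : (2 + 2 * Lam) * d <= rho ->
  (2 + 2 * Lam) * d' <= d -> `|z - x0| < d -> 0 < F z -> Omega z ->
  `|x - x0| < d' -> `|y - x0| < d' -> 0 <= F x -> 0 <= F y ->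
  exists m, [/\ seg_in (closure Omega) x m, seg_in (closure Omega) m y &
    `|m - x| + `|y - m| <= (1 + 2 * Lam) * `|x - y|].
Proof.
move=> drho dd zd Fz Oz xd yd Fx Fy.
have H a b : `|a - x0| < d' -> `|b - x0| < d' -> 0 <= F a ->
    seg_in (closure Omega) a (apex a b).
  move=> ad bd Fa s s01; apply: (above_closure drho zd _ Fz Oz).
    exact: lt_le_trans (apex_near ad bd s01) dd.
  by apply: le_trans Fa _; apply: apex_above; case/andP: s01.
exists (apex x y); split; first exact: H.
  by apply: seg_in_sym; rewrite apexC; exact: H.
have := apex_dist x y; have := apex_dist y x.
rewrite [apex y x]apexC [`|y - x|]distrC [`|y - _|]distrC; lra.
Qed.

End graph.

(** Near an interior point, straight segments suffice. Near a boundary point, the local graph says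
    where the boundary is but not on which side [Omega] lies, so the proof distinguishes the sides
    of the graph that [Omega] meets. *)
Lemma lipschitz_domain_chain (R : realType) (n : nat) (Omega : set 'rV[R]_n)
    (x0 : 'rV[R]_n) : lipschitz_domain Omega -> closure Omega x0 ->
  exists d K : R, [/\ 0 < d, 0 <= K & forall x y,
    closure Omega x -> closure Omega y -> `|x - x0| < d -> `|y - x0| < d ->
    exists m, [/\ seg_in (closure Omega) x m, seg_in (closure Omega) m y &
      `|m - x| + `|y - m| <= K * `|x - y|]].
Proof.
move=> [[_ oO _] HO] clx0.
have straight x y : seg_in (closure Omega) x y -> exists m,
    [/\ seg_in (closure Omega) x m, seg_in (closure Omega) m y &
      `|m - x| + `|y - m| <= 1 * `|x - y|].
  move=> xy; exists y; split=> //.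
    by move=> s _; rewrite subrr scaler0 addr0; exact: seg_in_end xy.
  by rewrite subrr normr0 addr0 mul1r distrC.
have [Ox0|nOx0] := pselect (Omega x0).
  have /nbhs_ballP[d /= d0 dO] : nbhs x0 Omega by exact: open_nbhs_nbhs.
  exists d, 1; split => // x y _ _ xd yd; apply: straight.
  apply: seg_in_sub (seg_in_ball xd yd) => z /= zd; apply: subset_closure.
  by apply: dO; rewrite -ball_normE /ball_ /= distrC.
have [U [e [f [U0 ee flip bU]]]] := HO x0 ((boundary_open x0 oO).2 (conj clx0 nOx0)).
have /nbhs_ballP[rho /= rho0 rhoU] := U0.
pose proj (z : 'rV[R]_n) := z - dot z e *: e.
pose F z := dot z e - f (proj z).
have dotD x y : dot (x + y) e = dot x e + dot y e.
  by rewrite /dot -big_split /=; apply: eq_bigr => i _; rewrite !mxE mulrDl.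
have dotZ s x : dot (s *: x) e = s * dot x e.
  by rewrite /dot mulr_sumr; apply: eq_bigr => i _; rewrite !mxE mulrA.
have dee : dot e e = 1.
  have d0 : 0 <= dot e e by apply: sumr_ge0 => i _; rewrite -expr2 sqr_ge0.
  by rewrite -(sqr_sqrtr d0) -/(enorm e) ee expr1n.
have ei i : `|e 0 i| <= 1.
  rewrite -(@ler_pXn2r _ 2%N) ?nnegrE // expr1n -dee -normrX ger0_norm ?sqr_ge0 //.
  by rewrite /dot (bigD1 i) //= expr2 lerDl sumr_ge0 // => j _; rewrite -expr2 sqr_ge0.
have e1 : `|e| <= 1.
  rewrite [leLHS]/Num.norm /= mx_normrE; apply/bigmax_leP; split=> // -[i j] _ /=.
  by rewrite ord1.
have dotn x : `|dot x e| <= n%:R * `|x|.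
  apply: le_trans (ler_norm_sum _ _ _) _.
  apply: (@le_trans _ _ (\sum_(i < n) `|x|)); last first.
    by rewrite sumr_const card_ord mulr_natl.
  apply: ler_sum => i _; rewrite normrM -[leRHS]mulr1 ler_pM //.
  exact: mx_coord_le.
have projp z : dot (proj z) e = 0.
  by rewrite /proj -scaleNr dotD dotZ dee; lra.
have /pinfty_ex_gt0[M M0 HM] := flip.
(* In the sup norm, [dot z e] is [n]-Lipschitz and [proj] is [(1 + n)]-Lipschitz; [M] is the
   constant of [f]. *)
pose Lam := n%:R + M * (1 + n%:R).
have Lam0 : 0 <= Lam by rewrite addr_ge0 ?mulr_ge0 ?addr_ge0 ?ler0n // ltW.
have Fe z s : F (z + s *: e) = F z + s.
  rewrite /F; have -> : proj (z + s *: e) = proj z.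
    by rewrite /proj dotD dotZ dee mulr1 scalerDl opprD addrACA subrr addr0.
  by rewrite dotD dotZ dee; lra.
have FLam z z' : `|F z - F z'| <= Lam * `|z - z'|.
  have dB : dot z e - dot z' e = dot (z - z') e.
    by rewrite -[- z']scaleN1r dotD dotZ mulN1r.
  have -> : F z - F z' = dot (z - z') e - (f (proj z) - f (proj z')).
    by rewrite -dB /F; lra.
  apply: le_trans (ler_normB _ _) _; rewrite mulrDl; apply: lerD; first exact: dotn.
  have := HM (proj z, proj z') (conj (projp z) (projp z')); rewrite /= => /le_trans.
  apply; rewrite -mulrA ler_pM2l //.
  have -> : proj z - proj z' = (z - z') - dot (z - z') e *: e.
    by rewrite /proj -dB scalerBl !opprD !opprK; apply/rowP => i; rewrite !mxE; ring.
  apply: le_trans (ler_normB _ _) _; rewrite mulrDl mul1r lerD2l normrZ.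
  by apply: le_trans (dotn _); rewrite ler_piMr.
have FO z : `|z - x0| < rho -> (boundary Omega z <-> F z = 0).
  move=> zr; have Uz : U z by apply: rhoU; rewrite -ball_normE /ball_ /= distrC.
  have bE : boundary Omega z <-> (boundary Omega `&` U) z by split => // -[].
  apply: (iff_trans bE); rewrite bU; split=> [[/= + _]|/eqP].
    by rewrite -/(proj z) => H; rewrite /F H subrr.
  by rewrite subr_eq0 => /eqP H; split.
(* Each division makes room for one detour through an apex. *)
pose d := rho / (2 + 2 * Lam); pose d' := d / (2 + 2 * Lam).
have L20 : 0 < 2 + 2 * Lam by lra.
have d0 : 0 < d by rewrite divr_gt0.
have d'0 : 0 < d' by rewrite divr_gt0.
have dr : (2 + 2 * Lam) * d <= rho by rewrite /d mulrC divfK // gt_eqF.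
have dd : (2 + 2 * Lam) * d' <= d by rewrite /d' mulrC divfK // gt_eqF.
have d'd : d' <= d.
  by apply: le_trans dd; rewrite ler_peMl ?ltW //; lra.
have drho : d <= rho.
  by apply: le_trans dr; rewrite ler_peMl ?ltW //; lra.
have Fpm q : `|q - x0| < d -> Omega q -> F q <> 0.
  move=> qd Oq /(FO _ (lt_le_trans qd drho)) /(boundary_open _ oO)[_]; exact.
(* Reversing the vertical direction turns the side below the graph into the side above, with the
   same constants. *)
have NFe z s : - F (z + s *: - e) = - F z + s.
  by rewrite scalerN -scaleNr Fe opprD opprK.
have NFLam z z' : `|- F z - - F z'| <= Lam * `|z - z'|.
  by rewrite -opprD normrN.
have NFO z : `|z - x0| < rho -> (boundary Omega z <-> - F z = 0).
  move=> /FO H; apply: (iff_trans H).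
  by split=> [->|/eqP]; rewrite ?oppr0 // oppr_eq0 => /eqP.
have Ne1 : `|- e| <= 1 by rewrite normrN.
exists d', (1 + 2 * Lam); split=> //; first lra.
move=> x y clx cly xd yd.
(* If [Omega] meets both sides, its closure contains the whole small ball and segments suffice. If
   it meets one side, the closure lies weakly on that side and the apex path applies. It meets at
   least one, since [x0] is in the closure and [F] does not vanish on [Omega]. *)
have [[p [pd Fp Op]]|Np] := pselect (exists p, [/\ `|p - x0| < d, 0 < F p & Omega p]);
have [[q [qd Fq Oq]]|Nq] := pselect (exists p, [/\ `|p - x0| < d, F p < 0 & Omega p]).
- have [m [s1 s2 m3]] : exists m, [/\ seg_in (closure Omega) x m,
      seg_in (closure Omega) m y & `|m - x| + `|y - m| <= 1 * `|x - y|].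
    apply: straight; apply: seg_in_sub (seg_in_ball xd yd) => z /= zd.
    have {}zd := lt_le_trans zd d'd.
    have [Fz|Fz] := leP 0 (F z).
      exact: (above_closure oO e1 Lam0 Fe FLam FO dr pd zd Fp Op).
    apply: (above_closure oO Ne1 Lam0 NFe NFLam NFO dr qd zd _ Oq);
      by rewrite ?oppr_gt0 // oppr_ge0 ltW.
  exists m; split => //; apply: le_trans m3 _; rewrite ler_wpM2r //; lra.
- have H z : closure Omega z -> `|z - x0| < d' -> 0 <= F z.
    move=> clz zd; rewrite leNgt; apply/negP => Fz; apply: Nq; exists z.
    have {}zd := lt_le_trans zd d'd.
    split=> //; apply: closure_not_boundary => // /(FO _ (lt_le_trans zd drho)) F0.
    by rewrite F0 ltxx in Fz.
  by apply: (above_chain oO e1 Lam0 Fe FLam FO dr dd pd Fp Op) => //; exact: H.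
- have H z : closure Omega z -> `|z - x0| < d' -> 0 <= - F z.
    move=> clz zd; rewrite oppr_ge0 leNgt; apply/negP => Fz; apply: Np; exists z.
    have {}zd := lt_le_trans zd d'd.
    split=> //; apply: closure_not_boundary => // /(FO _ (lt_le_trans zd drho)) F0.
    by rewrite F0 ltxx in Fz.
  apply: (above_chain oO Ne1 Lam0 NFe NFLam NFO dr dd qd _ Oq) => //; try exact: H.
  by rewrite oppr_gt0.
- have [z [Oz zd]] : Omega `&` ball x0 d !=set0 by apply: clx0; exact: nbhsx_ballx.
  have {}zd : `|z - x0| < d by move: zd; rewrite -ball_normE /ball_ /= distrC.
  have /eqP := Fpm z zd Oz; case: (ltgtP (F z) 0) => // Fz _.
    by exfalso; apply: Nq; exists z.
  by exfalso; apply: Np; exists z.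
Qed.

(** * Tonelli Lagrangians *)

Section dot.
Context (R : realType) (n : nat).
Implicit Types (p q v w : 'rV[R]_n).

Lemma ler_norm_dot p v : `|dot p v| <= (\sum_i `|p 0 i|) * `|v|.
Proof.
apply: le_trans (ler_norm_sum _ _ _) _; rewrite mulr_suml.
by apply: ler_sum => i _; rewrite normrM ler_wpM2l // mx_coord_le.
Qed.

Lemma dotBl p q v : dot (p - q) v = dot p v - dot q v.
Proof.
rewrite /dot -sumrB; apply: eq_bigr => i _; rewrite !mxE; ring.
Qed.

Lemma dotDr p v w : dot p (v + w) = dot p v + dot p w.
Proof.
rewrite /dot -big_split /=; apply: eq_bigr => i _; rewrite !mxE; ring.
Qed.

Lemma dotZr (a : R) p v : dot p (a *: v) = a * dot p v.
Proof. by rewrite /dot mulr_sumr; apply: eq_bigr => i _; rewrite mxE mulrCA. Qed.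

Lemma norm_le_enorm v : `|v| <= enorm v.
Proof.
rewrite [leLHS]/Num.norm /= mx_normrE; apply/bigmax_leP.
split=> [|[i j] _] /=; first exact: sqrtr_ge0.
rewrite ord1 -sqrtr_sqr ler_wsqrtr // /dot (bigD1 j) //= expr2 lerDl.
by apply: sumr_ge0 => k _; rewrite -expr2 sqr_ge0.
Qed.

Lemma enorm_le_dim v : `|v| <= 1 -> enorm v <= n%:R.
Proof.
move=> v1; have n0 : (0 : R) <= n%:R by rewrite ler0n.
rewrite -(ger0_norm n0) -sqrtr_sqr ler_wsqrtr //.
apply: (@le_trans _ _ n%:R).
  apply: (@le_trans _ _ (\sum_(i < n) 1)); last by rewrite sumr_const card_ord.
  apply: ler_sum => i _; rewrite -expr2 -real_normK ?num_real // expr_le1 //.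
  exact: le_trans (mx_coord_le _ _) v1.
by rewrite expr2 -natrM ler_nat; case: (n) => // m; rewrite leq_pmulr.
Qed.

(** Expanding a vector in the canonical basis identifies the differential with the pairing against
    the vector of partial derivatives. *)
Lemma differentiable_grad (phi : 'rV[R]_n -> R) (x : 'rV[R]_n) (eps : R) :
  differentiable phi x -> 0 < eps ->
  \forall y \near x,
    `|phi y - phi x - dot (grad phi x) (y - x)| <= eps * `|y - x|.
Proof.
move=> dphi e0.
have dE w : 'd phi x w = dot (grad phi x) w.
  rewrite [w in LHS](matrix_sum_delta w) big_ord1 linear_sum.
  apply: eq_bigr => i _; rewrite linearZ /= /grad mxE deriveE //.
  by rewrite mulrC.
have /eqaddoP/(_ _ e0) H := diff_locally dphi.
apply/nbhs0P; near=> w; have -> : x + w - x = w by rewrite addrC addKr.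
have -> : phi (x + w) - phi x - dot (grad phi x) w =
    ((phi \o shift x) - (cst (phi x) + 'd phi x)) w.
  by rewrite -dE /= [x + w]addrC opprD addrA.
by near: w.
Unshelve. all: end_near. Qed.

End dot.

Section tonelli.
Context (R : realType) (n : nat) (L : 'rV[R]_n -> 'rV[R]_n -> R).
Hypothesis tL : tonelli L.
Implicit Types (x y p q v w : 'rV[R]_n).

Lemma tonelli_continuous : continuous (fun z : 'rV[R]_n * 'rV[R]_n => L z.1 z.2).
Proof.
have [[dL _] _ _] := tL => z.
by apply: differentiable_continuous; exact: dL.
Qed.

Lemma tonelli_bounded_below : exists2 c : R, 0 <= c & forall x v, - c <= L x v.
Proof.
have [_ _ [t1 [t2 [c0 [[t1_ge0 _ _] _ c0_gt0 H]]]]] := tL.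
exists c0 => [|x v]; first exact: ltW.
have [+ _] := H x v; apply: le_trans.
by rewrite lerDr t1_ge0 // sqrtr_ge0.
Qed.

Lemma tonelli_bounded_unit_ball :
  exists2 B : R, 0 <= B & forall x v, `|v| <= 1 -> L x v <= B.
Proof.
have [_ _ [t1 [t2 [c0 [_ [t2_ge0 t2_mono _] _ H]]]]] := tL.
exists (t2 n%:R) => [|x v v1]; first by rewrite t2_ge0 ?ler0n.
have [_ +] := H x v => /le_trans; apply.
by apply: t2_mono; [exact: sqrtr_ge0|exact: enorm_le_dim].
Qed.

Lemma tonelli_superlinear (K : R) : 0 <= K ->
  exists2 M : R, 0 <= M & forall x v, M <= `|v| -> K * `|v| <= L x v.
Proof.
move=> K0.
have [_ _ [t1 [t2 [c0 [[t1_ge0 _ t1_lim] _ c0_gt0 H]]]]] := tL.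
(* The slope [K + c0] rather than [K]: once [enorm v] is at least 1, the extra [c0 * enorm v]
   absorbs the constant [- c0] of the lower bound. *)
move/cvgryPge : t1_lim => /(_ (K + c0)) [M [_ HM]].
exists (`|M| + 1) => [|x v Mv]; first by rewrite addr_ge0.
have vr := norm_le_enorm v; have := HM (enorm v).
have MM := ler_norm M; have M0 := normr_ge0 M.
have r1 : 1 <= enorm v by lra.
have r0 : 0 < enorm v by lra.
have [+ _] := H x v => Lt /(_ ltac:(lra)); rewrite ler_pdivlMr // => tr.
have : K * `|v| <= K * enorm v by rewrite ler_wpM2l.
have : c0 * 1 <= c0 * enorm v by rewrite ler_wpM2l // ltW.
lra.
Qed.

(** A negative supremum leaves a gap [eta] uniform in [v]. For large [v], superlinearity wins for
    every [y]. For [v] in a compact ball, half of the gap pays for moving [x] to [y] and half for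
    moving [p] to [q]. *)
Lemma hamiltonian_lt0 x p : (hamiltonian L x p < 0)%E ->
  exists2 k : R, 0 < k & \forall y \near x, forall q v,
    (forall i, `|q 0 i - p 0 i| <= k) -> dot q v <= L y v.
Proof.
move=> Hneg.
have [eta eta0 Heta] : exists2 eta : R, 0 < eta &
    forall v, dot p v - L x v <= - eta.
  have ub v : ((dot p v - L x v)%:E <= hamiltonian L x p)%E.
    by apply: ereal_sup_ubound; exists v.
  case: (hamiltonian L x p) Hneg ub => [r||] //.
    rewrite lte_fin => r0 ub; exists (- r) => [|v]; first by rewrite oppr_gt0.
    by rewrite opprK -lee_fin.
  (* The value [-oo] is excluded by the term [v = 0] of the supremum. *)
  by move=> _ /(_ 0).
pose K := (\sum_i `|p 0 i|) + n%:R.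
have K0 : 0 <= K by rewrite addr_ge0 ?ler0n // sumr_ge0.
have [M M0 HM] := tonelli_superlinear K0.
(* The bound 1 keeps the [l^1] norm of [q] below [K]; the other one gives [k * n * M <= eta / 2],
   where the added 1 keeps the denominator positive. *)
pose k := Num.min 1 (eta / (2 * (n%:R * M + 1))).
have nM1 : 0 < n%:R * M + 1 by rewrite ltr_wpDl // mulr_ge0 ?ler0n.
have k0 : 0 < k by rewrite lt_min ltr01 divr_gt0 // mulr_gt0.
have k1 : k <= 1 by rewrite ge_min lexx.
have keta : k * (n%:R * M) <= eta / 2.
  apply: (@le_trans _ _ (k * (n%:R * M + 1))); first by rewrite ler_pM2l // lerDl.
  have : k <= eta / (2 * (n%:R * M + 1)) by rewrite ge_min lexx orbT.
  rewrite ler_pdivlMr ?mulr_gt0 //; lra.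
exists k => //.
have cB : compact [set v : 'rV[R]_n | `|v| <= M].
  apply: bounded_closed_compact.
    exists M; split=> [|N MN v /= vM]; first exact: num_real.
    exact: le_trans vM (ltW MN).
  rewrite (_ : [set v | _] = (fun v => `|v|) @^-1` [set t | t <= M]) //.
  by apply: preimage_closed => [v _|]; [exact: norm_continuous|exact: closed_le].
have unif : \forall y \near x, [set v : 'rV[R]_n | `|v| <= M] `<=`
    [set v | L x v - eta / 2 <= L y v].
  apply: ((compact_near_coveringP _).1 cB _ (nbhs x)
    (fun y v => L x v - eta / 2 <= L y v)) => v vM.
  have /cvgrPdist_lt/(_ (eta / 4) ltac:(lra)) c1 := @tonelli_continuous (x, v).
  have [[A B] /= [Ax Bv] AB] := c1.
  exists (B, A) => // -[v' y] /= [Bv' Ay].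
  have := AB (x, v') (conj (nbhs_singleton Ax) Bv').
  have := AB (y, v') (conj Ay Bv'); rewrite /= !ltr_norml; lra.
near=> y => q v qp.
have [vM|Mv] := leP M `|v|.
  apply: le_trans (HM y v vM); apply: le_trans (ler_norm _) _.
  apply: le_trans (ler_norm_dot _ _) _; rewrite ler_wpM2r // /K.
  rewrite -[n in n%:R]card_ord -sumr_const -big_split /=; apply: ler_sum => i _.
  have := ler_normD (q 0 i - p 0 i) (p 0 i); rewrite subrK.
  have := qp i; lra.
have Lv : L x v - eta / 2 <= L y v by apply: (near unif y _) => //; exact: ltW.
have dqp : dot q v - dot p v <= k * (n%:R * M).
  rewrite -dotBl; apply: le_trans (ler_norm _) _.
  apply: le_trans (ler_norm_dot _ _) _; rewrite mulrA; apply: ler_pM => //.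
  - by apply: sumr_ge0 => i _.
  - apply: (@le_trans _ _ (\sum_(i < n) k)).
      by apply: ler_sum => i _; rewrite !mxE; exact: qp.
    by rewrite sumr_const card_ord mulr_natr.
  - exact: ltW.
have := Heta v; lra.
Unshelve. all: end_near. Qed.

End tonelli.

(** * The value function *)

(** This property is shared by the value function and by all potentials [mane_potential Omega L z].
    Values are extended reals because finiteness is deduced from it. *)
Definition dominated (R : realType) (n : nat) (Omega : set 'rV[R]_n)
    (L : 'rV[R]_n -> 'rV[R]_n -> R) (V : 'rV[R]_n -> \bar R) : Prop :=
  forall (y w : 'rV[R]_n) (h B : R), 0 <= h ->
    (forall s, 0 <= s <= h -> closure Omega (y + s *: w)) ->
    (forall s, 0 <= s <= h -> L (y + s *: w) w <= B) ->
    (V (y + h *: w)%R <= V y + (B * h)%:E)%E.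

Section value.
Context (R : realType) (n : nat) (Omega : set 'rV[R]_n).
Context (L : 'rV[R]_n -> 'rV[R]_n -> R) (g : 'rV[R]_n -> R).
Hypothesis n0 : (0 < n)%N.
Hypothesis bO : bounded_set Omega.
Hypothesis lipO : lipschitz_domain Omega.
Hypothesis tL : tonelli L.
Hypothesis compat : forall x y : 'rV[R]_n, boundary Omega x -> boundary Omega y ->
  ((g x - g y)%:E <= mane_potential Omega L y x)%E.

Let oO : open Omega. Proof. by case: lipO => -[]. Qed.

Lemma mane_dominated z : dominated Omega L (mane_potential Omega L z).
Proof.
move=> y w h B h0 clw LB.
have [c c0 Lc] := tonelli_bounded_below tL.
exact: (mane_segment (tonelli_continuous tL) Lc c0 z h0 clw LB).
Qed.

Lemma value_dominated : dominated Omega L (value_function Omega L g).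
Proof.
move=> y w h B h0 clw LB; rewrite -leeBlDr //.
apply: le_ereal_inf_tmp => _ [z /= bz <-]; rewrite EFinN leeBlDr // -addeA.
apply: (@le_trans _ _ ((g z)%:E + mane_potential Omega L z (y + h *: w))%E).
  by apply: ereal_inf_lbound; exists z.
by rewrite leeD2l //; exact: mane_dominated.
Qed.

(** The segment is run at unit speed for the sup norm, where [L] is bounded by a constant, so its
    cost is proportional to its length. *)
Lemma dominated_seg_in : exists2 B : R, 0 <= B & forall V x y,
  dominated Omega L V -> seg_in (closure Omega) x y ->
  (V y <= V x + (B * `|y - x|)%:E)%E.
Proof.
have [B B0 LB] := tonelli_bounded_unit_ball tL.
exists B => // V x y dV xy.
have [->|yx] := eqVneq y x; first by rewrite subrr normr0 mulr0 adde0.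
have h0 : 0 < `|y - x| by rewrite normr_gt0 subr_eq0.
set h := `|y - x| in h0 *.
have -> : V y = V (x + h *: (h^-1 *: (y - x))).
  by rewrite scalerA mulfV ?gt_eqF // scale1r addrC subrK.
apply: dV => [|s /andP[s0 sh]|s _]; first exact: ltW.
- rewrite scalerA; apply: xy; rewrite divr_ge0 //=; last exact: ltW.
  by rewrite ler_pdivrMr ?mul1r.
- by apply: LB; rewrite normrZ normfV /h normr_id mulVf // gt_eqF.
Qed.

Lemma dominated_locally_lipschitz x0 : closure Omega x0 ->
  exists d K : R, [/\ 0 < d, 0 <= K & forall V x y, dominated Omega L V ->
    closure Omega x -> closure Omega y -> `|x - x0| < d -> `|y - x0| < d ->
    (V y <= V x + (K * `|x - y|)%:E)%E].
Proof.
move=> clx0; have [B B0 HB] := dominated_seg_in.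
have [d [K [d0 K0 H]]] := lipschitz_domain_chain lipO clx0.
exists d, (B * K); split=> //; first exact: mulr_ge0.
move=> V x y dV clx cly xd yd; have [m [xm my mK]] := H x y clx cly xd yd.
apply: le_trans (HB V m y dV my) _.
apply: le_trans (leeD2r _ (HB V x m dV xm)) _.
rewrite -addeA -EFinD leeD2l // lee_fin -mulrDr -mulrA.
by rewrite ler_wpM2l // addrC.
Qed.

(** By the local estimate, the points reachable from [x] at finite cost form an open and closed
    subset of the connected set [closure Omega]. The constant does not depend on [V], which later
    allows an infimum over all potentials. *)
Lemma dominated_bounded_oscillation x y : closure Omega x -> closure Omega y ->
  exists C : R, forall V, dominated Omega L V -> (V y <= V x + C%:E)%E.
Proof.
move=> clx cly.
pose osc z := exists C : R, forall V, dominated Omega L V -> (V z <= V x + C%:E)%E.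
have oscE (a b : 'rV[R]_n) (K : R) : (forall V, dominated Omega L V ->
    (V b <= V a + K%:E)%E) -> osc a -> osc b.
  move=> ab [C HC]; exists (C + K) => V dV; apply: le_trans (ab V dV) _.
  by rewrite EFinD addeA leeD2r // HC.
suff : closure Omega `&` [set z | osc z] = closure Omega.
  move=> E; have : (closure Omega `&` [set z | osc z]) y by rewrite E.
  by case.
have /connected_closure : connected Omega by case: lipO => -[].
apply.
- by exists x; split=> //; exists 0 => V _; rewrite adde0.
- exists [set z | closure Omega z -> osc z]°; first exact: open_interior.
  apply/seteqP; split=> z [clz oz]; split=> //; last exact: (interior_subset oz).
  have [d [K [d0 K0 H]]] := dominated_locally_lipschitz clz.
  apply/nbhs_ballP; exists d => //= y' zy' cly'.
  apply: oscE oz => V dV; apply: H => //; first by rewrite subrr normr0.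
  by move: zy'; rewrite -ball_normE /ball_ /= distrC.
- exists (closure (closure Omega `&` [set z | osc z])); first exact: closed_closure.
  apply/seteqP; split=> z [clz oz]; split=> //; first exact: subset_closure.
  have [d [K [d0 K0 H]]] := dominated_locally_lipschitz clz.
  have [a [[cla oa] za]] := oz _ (nbhsx_ballx z d d0).
  apply: oscE oa => V dV; apply: H => //; last by rewrite subrr normr0.
  by move: za; rewrite -ball_normE /ball_ /= distrC.
Qed.

Lemma mane_refl_le0 x : closure Omega x -> (mane_potential Omega L x x <= 0)%E.
Proof.
move=> clx; apply/lee_addgt0Pr => e e0; rewrite add0e.
(* Staying at [x] during time [t] costs [L x 0 * t], which is at most [e]. *)
pose t := e / (`|L x 0| + 1).
have l0 : 0 < `|L x 0| + 1 by rewrite ltr_wpDl.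
have t0 : 0 < t by rewrite divr_gt0.
have Hx : W11_deriv 0 t (cst x) (cst 0).
  split=> [i|r i _].
    apply: (eq_integrable _ (cst 0%E)) => //; last exact: integrable0.
    by move=> r _; rewrite /= mxE.
  rewrite (@eq_Rintegral _ _ _ _ _ (cst 0)) => [|r' _]; last by rewrite /= mxE.
  by rewrite Rintegral_cst // mul0r addr0.
apply: (@le_trans _ _ (min_action Omega L t x x)).
  by apply: ereal_inf_lbound; exists t.
apply: (@le_trans _ _ (action L t (cst x) (cst 0))).
  apply: ereal_inf_lbound; exists (cst x), (cst 0); split=> //; split=> //.
  by exists (cst 0).
rewrite /action /= integral_cst //= lebesgue_measure_itv /= lte_fin t0 -EFinB.
rewrite -EFinM lee_fin subr0; apply: (@le_trans _ _ (`|L x 0| * t)).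
  by rewrite ler_pM2r // ler_norm.
by rewrite /t mulrCA ler_piMr 1?ltW // ltr_pdivrMr // mul1r ltrDl.
Qed.

Lemma boundary_nonempty : exists y, boundary Omega y.
Proof.
apply: contrapT => nb; have [[a Oa] _ _] := lipO.1.
have [M [_ HM]] := bO.
(* A point outside the bounded set [Omega]; with an empty boundary, the segment from [a] to [b]
   could not leave [Omega]. *)
pose b : 'rV[R]_n := const_mx (`|M| + 2).
have Ob : Omega b.
  apply: (seg_in_end (seg_in_open oO (_ : seg_in _ a b) Oa)) => s _ bz.
  by apply: nb; eexists; exact: bz.
have bM : `|b| <= `|M| + 1 by apply: HM => //; have := ler_norm M; lra.
have := le_trans (mx_coord_le b (Ordinal n0)) bM.
by rewrite mxE ger0_norm ?addr_ge0 //; lra.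
Qed.

(** For the lower bound, every boundary point [z] is compared with a fixed [y0] through [compat],
    and going from [x] to [y0] costs at most [C'] whatever [z] is. For the upper bound, [y0] itself
    is a competitor. *)
Lemma value_fin_num x : closure Omega x -> value_function Omega L g x \is a fin_num.
Proof.
move=> clx; have [y0 by0] := boundary_nonempty.
have [cly0 _] := (boundary_open y0 oO).1 by0.
have [C HC] := dominated_bounded_oscillation cly0 clx.
have [C' HC'] := dominated_bounded_oscillation clx cly0.
rewrite fin_numE -ltNye -ltey; apply/andP; split.
  apply: (@lt_le_trans _ _ (g y0 - C')%:E); first exact: ltNyr.
  apply: le_ereal_inf_tmp => _ [z bz <-].
  have := compat by0 bz => /le_trans/(_ (HC' _ (mane_dominated z))).
  case: mane_potential => [r||] //=; rewrite ?leey //.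
  by rewrite -EFinD -EFinD !lee_fin; lra.
apply: (@le_lt_trans _ _ ((g y0)%:E + C%:E)%E); last exact: ltry.
apply: (@le_trans _ _ ((g y0)%:E + mane_potential Omega L y0 x)%E).
  by apply: ereal_inf_lbound; exists y0.
rewrite leeD2l //; apply: le_trans (HC _ (mane_dominated y0)) _.
by rewrite -[leRHS]add0e leeD2r // mane_refl_le0.
Qed.

(** The competitor [y = x] gives one inequality, and [compat] is the other. *)
Lemma value_boundary x : boundary Omega x -> fine (value_function Omega L g x) = g x.
Proof.
move=> bx; have [clx _] := (boundary_open x oO).1 bx.
suff -> : value_function Omega L g x = (g x)%:E by [].
apply/le_anti/andP; split.
  apply: (@le_trans _ _ ((g x)%:E + mane_potential Omega L x x)%E).
    by apply: ereal_inf_lbound; exists x.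
  by rewrite -[leRHS]adde0 leeD2l // mane_refl_le0.
apply: le_ereal_inf_tmp => _ [z bz <-].
by have := compat bx bz; rewrite EFinB leeBlDl.
Qed.

Lemma value_continuous :
  {within closure Omega, continuous (fun x => fine (value_function Omega L g x))}.
Proof.
apply/subspace_continuousP => x clx.
have [d [K [d0 K0 H]]] := dominated_locally_lipschitz clx.
apply/cvgrPdist_le => e e0.
have near1 : \forall y \near x, `|y - x| < d.
  by apply/nbhs_ballP; exists d => //= y; rewrite -ball_normE /ball_ /= distrC.
have near2 : \forall y \near x, `|y - x| < e / (K + 1).
  have eK : 0 < e / (K + 1) by rewrite divr_gt0 // ltr_wpDl.
  by apply/nbhs_ballP; exists (e / (K + 1)) => //= y;
    rewrite -ball_normE /ball_ /= distrC.
suff : \forall y \near x, closure Omega y ->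
    `|fine (value_function Omega L g x) - fine (value_function Omega L g y)| <= e.
  by [].
near=> y => cly.
have yd : `|y - x| < d by near: y.
have ye : `|y - x| < e / (K + 1) by near: y.
have xd : `|x - x| < d by rewrite subrr normr0.
have xy := H _ x y value_dominated clx cly xd yd.
have yx := H _ y x value_dominated cly clx yd xd.
move: xy yx; rewrite -(fineK (value_fin_num clx)) -(fineK (value_fin_num cly)).
rewrite -!EFinD !lee_fin [`|x - y|]distrC ler_norml => xy yx.
have : K * `|y - x| <= e.
  move: ye; rewrite ltr_pdivlMr ?ltr_wpDl //.
  by have := normr_ge0 (y - x); lra.
by move=> ?; apply/andP; split; lra.
Unshelve. all: end_near. Qed.

(** If [dot (grad phi x) v] exceeded [L x v], then along the short segment arriving at [x] with
    velocity [v] the function [phi] would grow faster than domination lets [u] grow, against the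
    maximality of [u - phi] at [x]. *)
Lemma value_subsolution : viscosity_subsolution (hamiltonian L) Omega
  (fun x => fine (value_function Omega L g x)).
Proof.
move=> phi x [dphi _] Ox xmax; pose u y := fine (value_function Omega L g y).
apply: ge_ereal_sup => _ [v _ <-]; rewrite lee_fin leNgt; apply/negP => pvL.
(* One third of the gap covers the variation of [L] along the segment, one third the first-order
   error of [phi], and one third remains. *)
pose eta := (dot (grad phi x) v - L x v) / 3.
have eta0 : 0 < eta by rewrite divr_gt0.
have v1 : 0 < `|v| + 1 by rewrite ltr_wpDl.
have Hphi := differentiable_grad (dphi x Ox) (divr_gt0 eta0 v1).
have /cvgrPdist_lt/(_ _ eta0) [[A B] /= [Ax Bv] AB] :=
  @tonelli_continuous _ _ _ tL (x, v).
have nO : nbhs x Omega by exact: open_nbhs_nbhs.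
have [r /= r0 Hr] := (nbhs_ballP x _).1
  (filterI (filterI xmax Hphi : nbhs x _) (filterI Ax nO : nbhs x _)).
have near_line s : `|s| < r / (`|v| + 1) -> ball x r (x - s *: v).
  move=> sr; rewrite -ball_normE /ball_ /= opprB addrC subrK normrZ.
  move: sr; rewrite ltr_pdivlMr //; apply: le_lt_trans.
  by rewrite ler_wpM2l // lerDl.
pose h := r / (`|v| + 1) / 2.
have rv0 : 0 < r / (`|v| + 1) by rewrite divr_gt0.
have h0 : 0 < h by rewrite divr_gt0.
have hr : h < r / (`|v| + 1) by rewrite /h; lra.
have line s : 0 <= s <= h -> ball x r (x - h *: v + s *: v).
  move=> /andP[s0 sh].
  rewrite (_ : _ + _ = x - (h - s) *: v).
    by apply: near_line; rewrite ger0_norm ?subr_ge0 //; lra.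
  by rewrite scalerBl opprB addrA addrAC.
have dom := @value_dominated (x - h *: v) v h (L x v + eta) (ltW h0).
have [[ymax yphi] [_ Oy]] := Hr _ (near_line h ltac:(by rewrite gtr0_norm)).
have cl_line s : 0 <= s <= h -> closure Omega (x - h *: v + s *: v).
  by move=> /line/Hr[_ [_ Os]]; exact: subset_closure.
have L_line s : 0 <= s <= h -> L (x - h *: v + s *: v) v <= L x v + eta.
  move=> /line/Hr[_ [As _]].
  have := AB (x - h *: v + s *: v, v) (conj As (nbhs_singleton Bv)).
  by rewrite /= ltr_norml; lra.
have := dom cl_line L_line; rewrite subrK.
rewrite -(fineK (value_fin_num (subset_closure Ox))).
rewrite -(fineK (value_fin_num (subset_closure Oy))) -EFinD lee_fin => uu.
rewrite -/(u x) -/(u (x - h *: v)) in uu.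
have hv : x - h *: v - x = (- h) *: v by rewrite addrAC subrr add0r scaleNr.
move: yphi; rewrite hv dotZr normrZ normrN (gtr0_norm h0).
rewrite ler_norml => /andP[_ yphi].
have : eta / (`|v| + 1) * (h * `|v|) <= eta * h.
  by rewrite mulrAC ler_pdivrMr // -[leRHS]mulrA ler_pM2l // ler_pM2l // lerDl.
have : h * dot (grad phi x) v = h * (L x v + 3 * eta).
  by congr (_ * _); rewrite /eta; field.
have : 0 < h * eta by rewrite mulr_gt0.
move: ymax => /=; rewrite -/(u x) -/(u (x - h *: v)); lra.
Qed.

End value.

(** The time [s] is the supremum of the times at which [f] is at least [r]; continuity at [s] from
    both sides forces [f s = r]. *)
Lemma last_exit_time (R : realType) (f : R -> R) (t r : R) : 0 <= t ->
  {within `[0, t], continuous f} -> r <= f 0 -> f t < r ->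
  exists s, [/\ 0 <= s, s < t, f s = r & forall q, s <= q <= t -> f q <= r].
Proof.
move=> t0 /subspace_continuousP cf f0 ft.
have {}cf s eps : 0 <= s <= t -> 0 < eps -> exists2 d, 0 < d &
    forall q, 0 <= q <= t -> `|q - s| < d -> `|f q - f s| < eps.
  move=> st e0; have sin : `[0, t]%classic s by rewrite /= in_itv.
  have /cvgrPdist_lt/(_ _ e0) := cf s sin.
  rewrite /within /= => /nbhs_ballP[d /= d0 Hd].
  exists d => // q qt qs; rewrite distrC; apply: Hd; last by rewrite /= in_itv.
  by rewrite /ball /= distrC.
pose A : set R := [set s | 0 <= s <= t /\ r <= f s].
have A0 : A 0 by split; rewrite ?lexx.
have At : ubound A t by move=> s [/andP[]].
have hsA : has_sup A by split; [exists 0|exists t].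
pose s := sup A.
have s0 : 0 <= s by apply: ub_le_sup => //; exists t.
have st : s <= t by apply: ge_sup => //; exists 0.
have above q : s < q -> q <= t -> f q < r.
  move=> sq qt; rewrite ltNge; apply/negP => fq.
  have : q <= s by apply: ub_le_sup; [exists t|split=> //; rewrite (le_trans s0) // ltW].
  by rewrite leNgt sq.
have fs : r <= f s.
  rewrite leNgt; apply/negP => fsr.
  have [d d0 Hd] := cf s (r - f s) ltac:(by rewrite s0 st)
    ltac:(by rewrite subr_gt0).
  have [q [/andP[q0 qt] fq] sq] := sup_adherent d0 hsA.
  have qs : q <= s by apply: ub_le_sup; [exists t|split=> //; rewrite q0].
  have := Hd q; rewrite q0 qt => /(_ isT); rewrite !ltr_norml.
  by move=> /(_ ltac:(rewrite -/s in sq; lra)); lra.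
have {}st : s < t.
  rewrite lt_neqAle st andbT; apply/eqP => E.
  by move: ft; rewrite -E ltNge fs.
have fsr : f s = r.
  apply/le_anti; rewrite fs andbT leNgt; apply/negP => rfs.
  have [d d0 Hd] := cf s (f s - r) ltac:(by rewrite s0 ltW)
    ltac:(by rewrite subr_gt0).
  (* A time after [s], close enough to it and still in the interval. *)
  pose q := Num.min t (s + d / 2).
  have sq : s < q by rewrite lt_min st /=; lra.
  have qt : q <= t by rewrite ge_min lexx.
  have qd : q <= s + d / 2 by rewrite ge_min lexx orbT.
  have fq := above q sq qt.
  have := Hd q; rewrite qt (le_trans s0 (ltW sq)) => /(_ isT).
  by rewrite !ltr_norml => /(_ ltac:(lra)); lra.
exists s; split=> // q /andP[]; rewrite le_eqVlt => /predU1P[<- _|sq qt].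
  by rewrite fsr.
by rewrite ltW // above.
Qed.

(** * Supersolution property *)

Section supersolution.
Context (R : realType) (n : nat) (Omega : set 'rV[R]_n).
Context (L : 'rV[R]_n -> 'rV[R]_n -> R) (g : 'rV[R]_n -> R).
Notation mu := (@lebesgue_measure R).
Hypothesis n0 : (0 < n)%N.
Hypothesis bO : bounded_set Omega.
Hypothesis lipO : lipschitz_domain Omega.
Hypothesis tL : tonelli L.
Hypothesis compat : forall x y : 'rV[R]_n, boundary Omega x -> boundary Omega y ->
  ((g x - g y)%:E <= mane_potential Omega L y x)%E.

Lemma sum_dist_continuous (t : R) xi v (x : 'rV[R]_n) : 0 <= t ->
  W11_deriv 0 t xi v ->
  {within `[0, t], continuous (fun s => \sum_i `|xi s 0 i - x 0 i|)}.
Proof.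
move=> t0 Hv; apply/subspace_continuousP => s st.
apply: cvg_big => [|i _]; first exact: add_continuous.
apply: cvg_norm; apply: cvgB; last exact: cvg_cst.
by have /subspace_continuousP := W11_continuous (i := i) t0 Hv; exact.
Qed.

(* The integral of a linear functional of the velocity only depends on the
   endpoints, which replaces the chain rule along the curve. *)
Lemma integral_dot (s t : R) xi v (q : 'rV[R]_n) : 0 <= s -> s <= t ->
  W11_deriv 0 t xi v ->
  mu.-integrable `]s, t] (EFin \o (fun r => dot q (v r))) /\
  (\int[mu]_(r in `]s, t]) (dot q (v r))%:E)%E = (dot q (xi t - xi s))%:E.
Proof.
move=> s0 st [vint xiE].
have sub : `]s, t]%classic `<=` `[0, t]%classic.
  by apply: subset_itvr; rewrite bnd_simp.
have vi i : mu.-integrable `]s, t] (EFin \o (fun r => v r 0 i)).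
  by apply: integrableS (vint i).
have qvi i : mu.-integrable `]s, t] (fun r => (q 0 i)%:E * (v r 0 i)%:E)%E.
  by apply: integrableZl => //; exact: vi.
have E : (EFin \o (fun r => dot q (v r))) =
    (fun r => \sum_(i < n) ((q 0 i)%:E * (v r 0 i)%:E))%E.
  by apply/funext => r; rewrite /= /dot -sumEFin; apply: eq_bigr => i _.
have Vi i : (\int[mu]_(r in `]s, t]) (v r 0 i)%:E)%E = ((xi t - xi s) 0 i)%:E.
  have vfin : (\int[mu]_(r in `]s, t]) (v r 0 i)%:E)%E \is a fin_num.
    by apply: integrable_fin_num => //; exact: vi.
  rewrite -(fineK vfin); congr (_%:E).
  rewrite !mxE (xiE t i) ?(le_trans s0 st) ?lexx // (xiE s i) ?s0 ?st //.
  rewrite (itvcc_setU s0 st) Rintegral_setU //.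
  - by rewrite /Rintegral; lra.
  - by rewrite -(itvcc_setU s0 st); exact: vint.
  - exact: itvcc_disj.
split; first by rewrite E; apply: integrable_sum => // i _; exact: qvi.
rewrite (_ : (fun r => _) = EFin \o (fun r => dot q (v r))) // E integral_sum //.
rewrite /dot -sumEFin; apply: eq_bigr => i _.
by rewrite integralZl //; [rewrite Vi|exact: vi].
Qed.

Lemma value_supersolution : viscosity_supersolution (hamiltonian L) Omega
  (fun x => fine (value_function Omega L g x)).
Proof.
move=> phi x [dphi _] Ox xmin; pose u y := fine (value_function Omega L g y).
have oO : open Omega by case: lipO => -[].
have fin y : closure Omega y -> value_function Omega L g y = (u y)%:E.
  by move=> cly; rewrite fineK //; exact: value_fin_num.
have clx : closure Omega x by exact: subset_closure.
rewrite leNgt; apply/negP => /(hamiltonian_lt0 tL)[k k0 Hk].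
have Hphi := differentiable_grad (dphi x Ox) (divr_gt0 k0 (ltr0Sn R 3)).
have nO : nbhs x Omega by exact: open_nbhs_nbhs.
have [r0 /= r00 Hr0] := (nbhs_ballP x _).1
  (filterI (filterI xmin Hphi : nbhs x _) (filterI Hk nO : nbhs x _)).
pose r := r0 / 2.
have rr0 : 0 < r by rewrite divr_gt0.
have near_x (y : 'rV[R]_n) : \sum_i `|y 0 i - x 0 i| <= r -> ball x r0 y.
  move=> yr; rewrite -ball_normE /ball_ /= distrC.
  apply: le_lt_trans (mx_norm_le_sum _) _.
  rewrite (eq_bigr (fun i => `|y 0 i - x 0 i|)); last by move=> i _; rewrite !mxE.
  by apply: le_lt_trans yr _; rewrite /r; lra.
(* Of the gain [k * r], half is spent on near optimality and a quarter on the first-order error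
   [k / 4 * r] of [phi]; a quarter remains for the contradiction. *)
have e0 : 0 < k * r / 2 by rewrite divr_gt0 // mulr_gt0.
have : (value_function Omega L g x < (u x + k * r / 2)%:E)%E.
  by rewrite fin // lte_fin ltrDl.
move=> /ereal_inf_lt[_ [y by_ <-]].
rewrite addeC -lteBrDr // => /ereal_inf_lt[_ [t /= t0 <-]].
move=> /ereal_inf_lt[_ [xi [v [Gxi Hv ->]]]] act.
have [c c0 Lc] := tonelli_bounded_below tL.
have cL := tonelli_continuous tL.
have Lint : mu.-integrable `[0, t] (fun r => (L (xi r) (v r))%:E).
  apply: (action_integrable (ltW t0) Hv cL Lc c0).
  by apply: lt_trans act _; rewrite -EFinB ltry.
have [_ xicl xi0 xit] := Gxi.
have [||s [s0 st fs sle]] := last_exit_time (ltW t0)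
    (sum_dist_continuous (x := x) (ltW t0) Hv) (r := r).
(* The curve starts at the boundary point [y], which is not in [Omega], whereas the [l^1]-ball of
   radius [r] around [x] lies inside [Omega]. *)
- rewrite xi0 leNgt; apply/negP => yr.
  have [_ nOy] := (boundary_open y oO).1 by_.
  by have [_ [_ /nOy]] := Hr0 _ (near_x y (ltW yr)).
- by rewrite xit big1 // => i _; rewrite subrr normr0.
pose q : 'rV[R]_n := \row_i (grad phi x 0 i + k * Num.sg (x 0 i - xi s 0 i)).
have qk i : `|q 0 i - grad phi x 0 i| <= k.
  rewrite !mxE addrAC subrr add0r normrM gtr0_norm // ler_piMr ?(ltW k0) //.
  by rewrite normr_sg; case: (_ != _).
(* The signs turn the pairing into [k] times the [l^1] distance from [xi s] to [x], which is exactly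
   [r] at the exit time. *)
have dotq : dot q (x - xi s) = dot (grad phi x) (x - xi s) + k * r.
  rewrite -fs mulr_sumr /dot -big_split /=; apply: eq_bigr => i _.
  rewrite !mxE mulrDl -mulrA; congr (_ + _ * _).
  by rewrite distrC [RHS]normrEsg.
have sin : 0 <= s <= t by rewrite s0 ltW.
have cls : closure Omega (xi s) by exact: xicl.
(* The potential is an infimum over positive times, so the restriction of [xi] to [[0, s]] competes
   for it only if [s] is positive. *)
have s_gt0 : 0 < s.
  rewrite lt_neqAle s0 andbT; apply/eqP => E.
  have [_ nOy] := (boundary_open y oO).1 by_.
  have [_ [_]] := Hr0 _ (near_x (xi s) (eq_ind_r (fun z => z <= r) (lexx r) fs)).
  by rewrite -E xi0.
have us : ((u (xi s))%:E <= (g y)%:E + action L s xi v)%E.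
  rewrite -fin //; apply: (@le_trans _ _ ((g y)%:E + mane_potential Omega L y (xi s))%E).
    by apply: ereal_inf_lbound; exists y.
  rewrite leeD2l //; apply: (@le_trans _ _ (min_action Omega L s y (xi s))).
    by apply: ereal_inf_lbound; exists s.
  apply: ereal_inf_lbound; exists xi, v; split=> //.
    exact: Gamma_restrict (ltW st) Gxi.
  exact: W11_restrict (ltW st) Hv.
(* After time [s] the curve stays in the ball, where [dot q w <= L y w] holds for every velocity
   [w]. *)
have tail : ((dot q (x - xi s))%:E <= \int[mu]_(r in `]s, t]) (L (xi r) (v r))%:E)%E.
  have [qint qE] := integral_dot q s0 (ltW st) Hv.
  rewrite -xit -qE; apply: le_integral => //.
    by apply: integrableS Lint => //; apply: subset_itvr; rewrite bnd_simp.
  move=> p; rewrite inE /= in_itv /= => /andP[sp pt]; rewrite lee_fin.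
  have [_ [Hkp _]] := Hr0 _ (near_x (xi p) (sle p ltac:(by rewrite (ltW sp)))).
  exact: Hkp.
have total : ((u (xi s) + dot q (x - xi s))%:E < (u x + k * r / 2)%:E)%E.
  rewrite EFinD; apply: (le_lt_trans (leeD us tail)).
  rewrite -addeA -(action_split cL s0 (ltW st) Hv) addeC.
  by rewrite -lteBrDr.
have [[xmin_s phi_s] _] := Hr0 _ (near_x (xi s) (eq_ind_r (fun z => z <= r) (lexx r) fs)).
have dist_s : `|xi s - x| <= r.
  apply: le_trans (mx_norm_le_sum _) _; rewrite -fs.
  by apply: ler_sum => i _; rewrite !mxE.
have dotN : dot (grad phi x) (xi s - x) = - dot (grad phi x) (x - xi s).
  by rewrite -[xi s - x]opprB -scaleN1r dotZr mulN1r.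
move: total phi_s xmin_s; rewrite lte_fin dotq dotN ler_norml /=.
rewrite -/(u x) -/(u (xi s)) => total /andP[phi_s _] xmin_s.
have : k / 4 * `|xi s - x| <= k / 4 * r by rewrite ler_wpM2l // divr_ge0 // ltW.
have : 0 < k * r by rewrite mulr_gt0.
lra.
Qed.

End supersolution.

Theorem corollary3p10 (R : realType) (n : nat) (Omega : set 'rV[R]_n)
    (L : 'rV[R]_n -> 'rV[R]_n -> R) (g : 'rV[R]_n -> R) :
  (0 < n)%N ->
  bounded_set Omega ->
  lipschitz_domain Omega ->
  tonelli L ->
  (forall x y : 'rV[R]_n, boundary Omega x -> boundary Omega y ->
     ((g x - g y)%:E <= mane_potential Omega L y x)%E) ->
  (critical_value Omega L < 0)%E ->
  (forall x : 'rV[R]_n, closure Omega x ->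
     value_function Omega L g x \is a fin_num) /\
  dirichlet_viscosity_solution (hamiltonian L) Omega g
    (fun x => fine (value_function Omega L g x)).
Proof.
move=> n0 bO lipO tL compat _; split; first exact: value_fin_num.
split.
- exact: value_continuous.
- exact: value_subsolution.
- exact: value_supersolution.
- exact: value_boundary.
Qed.
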